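(* Let $\mathsf{X}\in\mathbb{R}^{n\times r}$ have unit-norm columns and rank $r$. Let $Y$ be the random subset associated with $|\mathrm{columns}(\mathsf{X})\rangle$. Then for every $\mathtt{C}\subseteq\{1,\dots,n\}$, $$\mathbb{P}(Y=\mathtt{C})=\det\begin{bmatrix}0_{|\mathtt{C}|}&\mathsf{X}_{\mathtt{C}:}\\-(\mathsf{X}_{\mathtt{C}:})^\top&\mathrm{skew}(\mathsf{X}^\top\mathsf{X})\end{bmatrix}.$$ For $\mathtt{C}=\emptyset$ the matrix is understood as $\mathrm{skew}(\mathsf{X}^\top\mathsf{X})$. In particular, $\mathbb{P}\big(\mathrm{parity}(|Y|)\neq\mathrm{parity}(r)\big)=0$.
   Context: Work in $(\mathbb{C}^2)^{\otimes n}$ with $c_j=\sigma_z^{\otimes(j-1)}\otimes|0\rangle\langle1|\otimes I^{\otimes(n-j)}$ and $|\emptyset\rangle=|0\cdots0\rangle$. For a unit $x\in\mathbb{R}^n$, set $\mathcal{C}(x)=\sum_ix_i(c_i+c_i^* )$. Put $|\mathrm{columns}(\mathsf{X})\rangle=\mathcal{C}(\mathsf{X}_{:1})\cdots\mathcal{C}(\mathsf{X}_{:r})|\emptyset\rangle$; the order of the columns matters. The random subset $Y$ has law $\mathbb{P}(Y=\mathtt{C})=|\langle e_{\mathtt{C}}|\mathrm{columns}(\mathsf{X})\rangle|^2$, where $|e_{\mathtt{C}}\rangle=|b_1\dots b_n\rangle$ with $b_i=1$ iff $i\in\mathtt{C}$ (measurement of the occupation numbers $c_i^*c_i$). For a square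 matrix $M$, $\mathrm{triu}(M)$ is its upper-triangular part and $\mathrm{skew}(M)=\mathrm{triu}(M)-\mathrm{triu}(M)^\top$. $\mathsf{X}_{\mathtt{C}:}$ is the submatrix of rows indexed by $\mathtt{C}$ in increasing order, and $0_m$ is the $m\times m$ zero matrix. *)

(* Defs.v *)
From HB Require Import structures.
From mathcomp Require Import all_boot all_order all_algebra.
Set Implicit Arguments. Unset Strict Implicit. Unset Printing Implicit Defensive.
Import Order.TTheory GRing.Theory Num.Theory.
Local Open Scope ring_scope.

(* The Hilbert space (C^2)^{\otimes n} is represented in the computational
   basis |b_1 ... b_n> = |e_C>, where C = {i | b_i = 1} : {set 'I_n}
   (site i (1-based) in the paper is the ordinal i-1 here).  A state is the
   function C |-> <e_C|psi>.  All amplitudes involved are real (X is real and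
   the c_j have real matrix entries), so states have real coefficients. *)
Section Fock.
Variable R : realFieldType.
Variable n : nat.

Definition state := {set 'I_n} -> R.

(* sign produced by sigma_z^{\otimes (j-1)} on |e_T> : (-1)^#{i in T | i < j} *)
Definition jw_sign (T : {set 'I_n}) (j : 'I_n) : R :=
  (-1) ^+ #|[set i in T | (i < j)%N]|.

(* c_j = sigma_z^{(j-1)} (x) |0><1| (x) I^{(n-j)} :
   c_j |e_T> = jw_sign T j |e_{T \ j}> if j \in T, and 0 otherwise.
   Coefficient of e_S in c_j psi: *)
Definition cop (j : 'I_n) (psi : state) : state := fun S =>
  if j \in S then 0 else jw_sign (j |: S) j * psi (j |: S).

(* c_j^dagger |e_T> = jw_sign T j |e_{T u j}> if j \notin T, and 0 otherwise. *)
Definition cdag (j : 'I_n) (psi : state) : state := fun S =>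
  if j \in S then jw_sign (S :\ j) j * psi (S :\ j) else 0.

Definition Cop (x : 'I_n -> R) (psi : state) : state := fun S =>
  \sum_(i < n) x i * (cop i psi S + cdag i psi S).

Definition vac : state := fun S => (S == set0)%:R.

Definition columns_state (r : nat) (X : 'M[R]_(n, r)) : state :=
  foldr (fun j psi => Cop (fun i => X i j) psi) vac (enum 'I_r).

Definition probY (r : nat) (X : 'M[R]_(n, r)) (C : {set 'I_n}) : R :=
  (columns_state X C) ^+ 2.

Definition rowsub_set (r : nat) (X : 'M[R]_(n, r)) (C : {set 'I_n})
  : 'M[R]_(#|C|, r) := \matrix_(i, j) X (enum_val i) j.

End Fock.

Definition triu_mx (R : nzRingType) (m : nat) (M : 'M[R]_m) : 'M[R]_m :=
  \matrix_(i, j) if (i <= j)%N then M i j else 0.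

Definition skew_mx (R : nzRingType) (m : nat) (M : 'M[R]_m) : 'M[R]_m :=
  triu_mx M - (triu_mx M)^T.

(* Main.v *)
Require Import Defs.
From HB Require Import structures.
From mathcomp Require Import all_boot all_order all_algebra.
From mathcomp Require Import ring.
Set Implicit Arguments. Unset Strict Implicit. Unset Printing Implicit Defensive.
Import Order.TTheory GRing.Theory Num.Theory.
Local Open Scope ring_scope.

(* By Wick's theorem the amplitude <e_C|columns(X)> is the Pfaffian of the
   two-point contractions of the word c_(i_k) ... c_(i_1) C(X_:1) ... C(X_:r),
   where i_1 < ... < i_k are the elements of C.  It is proved by adding the
   operators C(X_:j) from the right to the left, since both sides obey the same
   recursion: moving C(X_:j) to the front of the word and expanding along it
   separates the contractions with the c_i, which give the creation part of
   C(X_:j), from those with the later C(X_:k), which give the annihilation part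
   because X_:j . X_:k = sum_i X_ij X_ik.

   The determinant of a skew matrix A is the square of its Pfaffian, by induction
   on an even size.  Delete the first row and column of A to get B, of odd size.
   The vector p_j = (-1)^j Pf (B without j) is in the kernel of B, because a
   Pfaffian with a repeated index vanishes.  For every u in this kernel,
   u_j^2 det A = (sum_k A_0k u_k)^2 p_j^2.  If p != 0, take u = p; if p = 0, any
   nonzero u gives det A = 0 = Pf A. *)

(** * Signed contractions of words *)

Section Contraction.
Variables (R : comNzRingType) (T : Type).
Implicit Types (phi psi : T -> R) (f g : seq T -> R) (t u v : seq T).

(* contr phi f t = sum_i (-1)^i phi(t_i) f(t without t_i), in a form on which the
   anticommutation of two contractions is a plain induction (see [contrE]). *)
Fixpoint contr phi f t : R :=
  if t is y :: t' then phi y * f t' - contr phi (fun s => f (y :: s)) t' else 0.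

Lemma eq_contr phi f g t :
  (forall s, (size s).+1 = size t -> f s = g s) -> contr phi f t = contr phi g t.
Proof.
elim: t f g => //= y t IH f g fg; rewrite fg //; congr (_ - _).
by apply: IH => s es; rewrite fg //= es.
Qed.

Lemma contr0f phi f t : (forall s, (size s).+1 = size t -> f s = 0) -> contr phi f t = 0.
Proof.
elim: t f => //= y t IH f f0; rewrite f0 // IH ?subr0 ?mulr0 // => s es.
by rewrite f0 //= es.
Qed.

Lemma contr_lin_f phi (a b : R) f g t :
  contr phi (fun s => a * f s - b * g s) t = a * contr phi f t - b * contr phi g t.
Proof. by elim: t f g => [|y t IH] f g /=; [ring | rewrite IH; ring]. Qed.

Lemma contrNf phi f t : contr phi (fun s => - f s) t = - contr phi f t.
Proof. by elim: t f => [|y t IH] f /=; [rewrite oppr0 | rewrite IH; ring]. Qed.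

Lemma contr_sum_phi (I : finType) (F : I -> T -> R) (a : I -> R) f t :
  contr (fun y => \sum_i a i * F i y) f t = \sum_i a i * contr (F i) f t.
Proof.
elim: t f => [|y t IH] f /=; first by rewrite big1 // => i _; rewrite mulr0.
rewrite IH mulr_suml -sumrB; apply: eq_bigr => i _; ring.
Qed.

Lemma contr_cat phi f u v :
  contr phi f (u ++ v) = contr phi (fun s => f (s ++ v)) u
    + (-1) ^+ size u * contr phi (fun s => f (u ++ s)) v.
Proof.
by elim: u f => [|y u IH] f /=; [ring | rewrite IH exprS; ring].
Qed.

(** Removing two letters in either order leaves the same word, but removing the left one first
    shifts the position of the other by one, which flips the sign. *)
Lemma contr_anticomm phi psi f t :
  contr phi (contr psi f) t = - contr psi (contr phi f) t.
Proof.
elim: t f => [|z t IH] f /=; first by rewrite oppr0.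
have E a b g : contr a (fun s => b z * g s - contr b (fun s => g (z :: s)) s) t =
   b z * contr a g t - contr a (contr b (fun s => g (z :: s))) t.
  rewrite -[X in _ - X]mul1r -contr_lin_f.
  by apply: eq_contr => s _; rewrite mul1r.
by rewrite !E IH; ring.
Qed.

Lemma contrE (x0 : T) phi f t :
  contr phi f t = \sum_(i < size t)
     (-1) ^+ i * phi (nth x0 t i) * f (take i t ++ drop i.+1 t).
Proof.
elim: t f => [|y t IH] f /=; first by rewrite big_ord0.
rewrite big_ord_recl /= drop0 expr0 mul1r IH; congr (_ + _).
rewrite -sumrN; apply: eq_bigr => i _; rewrite /bump /= add1n exprS /=; ring.
Qed.

End Contraction.

Lemma eq_in_contr (R : comNzRingType) (T : eqType) (phi psi : T -> R) f (t : seq T) :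
  {in t, phi =1 psi} -> contr phi f t = contr psi f t.
Proof.
elim: t f => //= y t IH f e; rewrite e ?mem_head // IH // => z zt.
by rewrite e // inE zt orbT.
Qed.

Lemma contr0phi (R : comNzRingType) (T : eqType) (phi : T -> R) f (t : seq T) :
  {in t, forall y, phi y = 0} -> contr phi f t = 0.
Proof.
elim: t f => //= y t IH f e; rewrite e ?mem_head // IH ?mul0r ?subr0 // => z zt.
by rewrite e // inE zt orbT.
Qed.

(** * Pfaffians of words *)

Section Pfaffian.
Variables (R : numFieldType) (T : Type) (w : T -> T -> R).
Hypothesis w_skew : forall x y, w x y = - w y x.
Implicit Types (s t u v : seq T).

(* [k] is meant to be the size of [s]. *)
Fixpoint pf_rec (k : nat) s : R :=
  match k, s with
  | k'.+2, x :: t => contr (w x) (pf_rec k') t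
  | 0, _ => 1
  | _, _ => 0
  end.

Definition pf s := pf_rec (size s) s.

Lemma pf_cons x t : pf (x :: t) = contr (w x) pf t.
Proof.
rewrite /pf /=; case: t => [|y t] //=.
by congr (_ - _); apply: eq_contr => s <-.
Qed.

Lemma pf_odd s : odd (size s) -> pf s = 0.
Proof.
have [m] := ubnP (size s); elim: m s => // m IH [|x t] //= lt_m odd_t.
rewrite pf_cons contr0f // => s es; apply: IH.
  by rewrite -ltnS es ltnW.
by move: odd_t; rewrite -es /= negbK.
Qed.

(** At the head of the word this is skewness of [w] and [contr_anticomm]. Elsewhere expand along the
    first letter: the contractions with [u] and [t] follow by induction, those with [x] and [y]
    trade places with opposite signs. *)
Lemma pf_swap u x y t : pf (u ++ x :: y :: t) = - pf (u ++ y :: x :: t).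
Proof.
have [m] := ubnP (size u); elim: m u t => // m IH [|z u] t /= lt_m.
  rewrite !pf_cons /= (w_skew y x).
  have E a b : contr (w a) (fun s => pf (b :: s)) t = contr (w a) (contr (w b) pf) t.
    by apply: eq_contr => s _; rewrite pf_cons.
  rewrite !E contr_anticomm; ring.
rewrite !pf_cons !contr_cat /=.
rewrite (@eq_contr _ _ _ _ (fun s => - pf (s ++ y :: x :: t)) u); last first.
  by move=> s es; rewrite IH // -ltnS es ltnW.
rewrite contrNf.
rewrite (@eq_contr _ _ _ _ (fun s => - pf (u ++ y :: x :: s)) t); last first.
  by move=> s es; rewrite IH.
rewrite contrNf; ring.
Qed.

Lemma pf_move v u x t :
  pf (v ++ u ++ x :: t) = (-1) ^+ size u * pf (v ++ x :: u ++ t).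
Proof.
elim/last_ind: u t => [|u y IH] t /=; first by rewrite mul1r.
by rewrite cat_rcons catA pf_swap -catA IH size_rcons exprS cat_rcons; ring.
Qed.

Lemma pf_repeat u x t : pf (x :: u ++ x :: t) = 0.
Proof.
have -> : pf (x :: u ++ x :: t) = (-1) ^+ size u * pf (x :: x :: u ++ t).
  exact: (pf_move [:: x]).
have e : pf (x :: x :: u ++ t) = - pf (x :: x :: u ++ t) := pf_swap [::] x x _.
by move/eqP: e; rewrite -addr_eq0 -mulr2n mulrn_eq0 /= => /eqP ->; rewrite mulr0.
Qed.

Lemma pf_repeat_nth x0 t i : (i < size t)%N -> pf (nth x0 t i :: t) = 0.
Proof.
by move=> lt_i; rewrite -[X in _ :: X](cat_take_drop i) (drop_nth x0) // pf_repeat.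
Qed.

Lemma pf_expand u x t :
  pf (u ++ x :: t) = (-1) ^+ size u * contr (w x) (fun s => pf (s ++ t)) u
     + contr (w x) (fun s => pf (u ++ s)) t.
Proof.
rewrite (pf_move [::]) /= pf_cons contr_cat mulrDr mulrA -expr2.
by rewrite sqrr_sign mul1r.
Qed.

(** Used to pass from the decreasing order of [annihilators] to the increasing order of the rows of
    the matrix. *)
Lemma sqr_pf_rev u t : pf (rev u ++ t) ^+ 2 = pf (u ++ t) ^+ 2.
Proof.
elim: u t => [|x u IH] t //; rewrite rev_cons cat_rcons IH (pf_move [::]) /=.
by rewrite exprMn sqrr_sign mul1r.
Qed.

End Pfaffian.

(** * Determinants of skew matrices *)

Section SkewDeterminant.

Lemma Cramer_delta_col (R : comNzRingType) (N : nat) (A : 'M[R]_N) (z : 'cV_N) (c : R) i j :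
  A *m z = c *: delta_mx i 0 -> z j 0 * \det A = c * cofactor A i j.
Proof.
move=> Az; have /matrixP/(_ j 0) : \adj A *m (A *m z) = \det A *: z.
  by rewrite mulmxA mul_adj_mx mul_scalar_mx.
rewrite Az -scalemxAr mxE [RHS]mxE [RHS]mulrC => <-.
rewrite mxE (bigD1 i) //= !mxE !eqxx mulr1 big1 ?addr0 // => k ki.
by rewrite !mxE (negPf ki) mulr0.
Qed.

Lemma Cramer_delta_row (R : comNzRingType) (N : nat) (A : 'M[R]_N) (z : 'rV_N) (c : R) i j :
  z *m A = c *: delta_mx 0 j -> z 0 i * \det A = c * cofactor A i j.
Proof.
move=> /(congr1 trmx); rewrite trmx_mul linearZ /= trmx_delta.
by move/(Cramer_delta_col i); rewrite mxE det_tr cofactor_tr.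
Qed.

(* Applying Cramer's rule to the columns and then to the rows of [A], with the
   null vector [u] both times, strips off the border and the index [j]. *)
Lemma det_skew_border (R : comNzRingType) (N : nat) (A : 'M[R]_N.+2) (u : 'cV[R]_N.+1) j :
  A^T = - A -> A 0 0 = 0 -> row' 0 (col' 0 A) *m u = 0 ->
  u j 0 ^+ 2 * \det A =
    (\sum_k A 0 (lift 0 k) * u k 0) ^+ 2 *
    \det (row' j (col' j (row' 0 (col' 0 A)))).
Proof.
move=> skA A00 Bu; set c := \sum_k _.
have skE i k : A i k = - A k i by move/matrixP/(_ k i): skA; rewrite !mxE.
have BuE i : \sum_k A (lift 0 i) (lift 0 k) * u k 0 = 0.
  move/matrixP/(_ i 0): Bu; rewrite [RHS]mxE mxE => Bui; rewrite -[RHS]Bui.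
  by apply: eq_bigr => k _; rewrite !mxE.
(* With a 0 put on top of [u], only the first entry of [A *m z] can be nonzero. *)
pose z : 'cV[R]_N.+2 := \col_k (if unlift 0 k is Some k' then u k' 0 else 0).
have zl k : z (lift 0 k) 0 = u k 0 by rewrite mxE liftK.
have Az : A *m z = c *: delta_mx 0 0.
  apply/matrixP => i k; rewrite ord1 !mxE big_ord_recl mxE unlift_none mulr0 add0r.
  under eq_bigr do rewrite zl.
  case: (unliftP 0 i) => [i' ->|->]; first by rewrite BuE /= mulr0.
  by rewrite !eqxx mulr1.
have {Az} := Cramer_delta_col (lift 0 j) Az; rewrite zl => e1.
set A' := row' 0 (col' (lift 0 j) A).
(* By skewness the first column of [A'] is minus the border row of [A], and [u] is orthogonal to the
   other columns. *)
have uA' : u^T *m A' = - c *: delta_mx 0 0.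
  apply/matrixP => i k; rewrite ord1 !mxE.
  under eq_bigr do rewrite !mxE.
  case: (unliftP 0 k) => [k' ->|->] /=.
    have -> : lift (lift 0 j) (lift 0 k') = lift 0 (lift j k').
      by apply: val_inj; rewrite /= /bump /= !add1n ltnS addnS.
    rewrite mulr0; have /(congr1 -%R) := BuE (lift j k'); rewrite oppr0 -sumrN.
    by apply: etrans; apply: eq_bigr => l _; rewrite skE; ring.
  have -> : lift (lift 0 j) 0 = 0 by apply: val_inj.
  rewrite mulr1 -sumrN; apply: eq_bigr => l _; rewrite skE; ring.
have := Cramer_delta_row j uA'; rewrite mxE => e2.
have eB : row' j (col' 0 A') = row' j (col' j (row' 0 (col' 0 A))).
  apply/matrixP => i k; rewrite !mxE; congr (A _ _).
  by apply: val_inj; rewrite /= /bump /= !add1n ltnS addnS.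
move: e1 e2; rewrite /cofactor -/A' eB /= /bump /= !add1n add0n addn0 exprS.
move: (\det A') (\det (row' j _)) (\det A) (u j 0) => d' d dA uj e1 e2.
rewrite expr2 -mulrA e1; transitivity (- c * (-1) ^+ j * (uj * d')); first ring.
rewrite e2; transitivity (c ^+ 2 * ((-1) ^+ j) ^+ 2 * d); first ring.
by rewrite sqrr_sign mulr1.
Qed.

Lemma det_skew_odd (R : numFieldType) (N : nat) (A : 'M[R]_N) :
  A^T = - A -> odd N -> \det A = 0.
Proof.
move=> skA oN; have := det_tr A; rewrite skA -scaleN1r detZ -signr_odd oN mulN1r.
by move/esym/eqP; rewrite -addr_eq0 -mulr2n mulrn_eq0 /= => /eqP.
Qed.

Lemma nth_del (T : Type) (x0 : T) (s : seq T) i k : (i <= size s)%N ->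
  nth x0 (take i s ++ drop i.+1 s) k = nth x0 s (bump i k).
Proof.
move=> le_i; rewrite nth_cat size_takel // /bump.
case: ltnP => [lt_k | le_k]; first by rewrite nth_take // leqNgt lt_k.
by rewrite nth_drop addSn subnKC.
Qed.

Lemma det_skew_pf (R : numFieldType) (T : Type) (w : T -> T -> R) (x0 : T) :
  (forall x y, w x y = - w y x) ->
  forall N (s : seq T), size s = N ->
  \det (\matrix_(i < N, j < N) w (nth x0 s i) (nth x0 s j)) = pf w s ^+ 2.
Proof.
move=> skw N; have [m] := ubnP N; elim: m N => // m IH N lt_m s sz.
set A := \matrix_(_, _) _.
have skA : A^T = - A by apply/matrixP => i j; rewrite !mxE skw.
case oN: (odd N); first by rewrite det_skew_odd // pf_odd ?sz // expr0n.
case: N => [|[|N]] // in lt_m sz A skA oN *.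
  by rewrite (size0nil sz) det_mx00 expr1n.
case: s => // x t in sz A skA *; case: sz => szt.
have A00 : A 0 0 = 0.
  move/matrixP/(_ 0 0): skA; rewrite !mxE => /eqP.
  by rewrite -addr_eq0 -mulr2n mulrn_eq0 /= => /eqP.
set B := row' 0 (col' 0 A).
pose del (j : nat) := take j t ++ drop j.+1 t.
pose p : 'cV[R]_N.+1 := \col_j ((-1) ^+ j * pf w (del j)).
have BE i j : B i j = w (nth x0 t i) (nth x0 t j) by rewrite !mxE.
have contrp y : contr (w y) (pf w) t = \sum_(j < N.+1) w y (nth x0 t j) * p j 0.
  rewrite (contrE x0) szt; apply: eq_bigr => j _; rewrite mxE; ring.
(* Row [i] of [B *m p] expands the Pfaffian of [nth x0 t i :: t], which has a repeated letter. *)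
have Bp : B *m p = 0.
  apply/matrixP => i k; rewrite ord1 !mxE -[RHS](pf_repeat_nth skw x0 (t := t) (i := i)) ?szt //.
  by rewrite pf_cons contrp; apply: eq_bigr => j _; rewrite BE.
have skB : B^T = - B by apply/matrixP => i j; rewrite mxE BE mxE BE skw.
have minorB (j : 'I_N.+1) : \det (row' j (col' j B)) = p j 0 ^+ 2.
  rewrite mxE exprMn sqrr_sign mul1r -(IH N).
  - congr (\det _); apply/matrixP => i k; rewrite mxE [LHS]mxE BE [RHS]mxE.
    by rewrite !nth_del // szt ltnW.
  - exact: ltnW lt_m.
  - have le_j : (j <= N)%N by rewrite -ltnS; apply: ltn_ord.
    by rewrite size_cat size_drop size_takel szt ?subSS ?subnKC // ltnW.
have key (u : 'cV[R]_N.+1) j : B *m u = 0 -> u j 0 ^+ 2 * \det A =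
    (\sum_(k < N.+1) w x (nth x0 t k) * u k 0) ^+ 2 * p j 0 ^+ 2.
  move=> Bu; rewrite (det_skew_border j) // minorB; congr (_ ^+ 2 * _).
  by apply: eq_bigr => k _; rewrite mxE.
rewrite pf_cons contrp.
have [p0 | pn0] := eqVneq p 0.
  have detB : \det B = 0 by apply: det_skew_odd => //; move: oN => /= /negbFE.
  have [u un0 uB] : exists2 u : 'rV_N.+1, u != 0 & u *m B = 0.
    by apply/det0P; rewrite detB.
  have /rV0Pn [j uj] := un0.
  have := key u^T j; rewrite p0 !mxE expr0n mulr0.
  (* Skewness of [B] turns the left null vector from [det0P] into a right one. *)
  have -> : B *m u^T = 0.
    by rewrite -[B]trmxK -trmx_mul skB mulmxN uB oppr0 trmx0.
  move=> /(_ erefl)/eqP; rewrite mulf_eq0 expf_eq0 /= (negPf uj) /= => /eqP ->.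
  by rewrite big1 ?expr0n // => k _; rewrite mxE mulr0.
have [j pj] : exists j, p j 0 != 0 by apply/cV0Pn.
apply: (@mulfI _ (p j 0 ^+ 2)); first by rewrite expf_eq0.
by rewrite (key _ j Bp) mulrC.
Qed.

End SkewDeterminant.

(** * Fermionic amplitudes as Pfaffians *)

Section Amplitudes.
Variables (R : realFieldType) (n r : nat) (X : 'M[R]_(n, r)).
Local Notation T := ('I_n + 'I_r)%type.

(* The contraction <0| a b |0> of two operators, where [inl i] stands for the
   annihilation operator c_i and [inr j] for C(X_:j), antisymmetrised according
   to the order in which the operators occur. *)
Definition wick (a b : T) : R :=
  match a, b with
  | inl i, inl k => 0
  | inl i, inr j => X i j
  | inr j, inl i => - X i j
  | inr j, inr k => skew_mx (X^T *m X) j k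
  end.

Lemma wick_skew a b : wick a b = - wick b a.
Proof. by case: a b => [i|j] [k|k] /=; rewrite ?oppr0 ?opprK // !mxE opprB. Qed.

Lemma wick_inr_lt (j k : 'I_r) : (j < k)%N ->
  wick (inr j) (inr k) = \sum_i X i j * wick (inl i) (inr k).
Proof.
move=> jk; rewrite /= !mxE (ltnW jk) leqNgt jk /= subr0.
by apply: eq_bigr => i _; rewrite mxE.
Qed.

(** The order is reversed because the bra of [C] is the adjoint of the creation operators applied in
    increasing order to the vacuum. *)
Definition annihilators (C : {set 'I_n}) : seq T := rev (map inl (enum C)).

Lemma enum_setU1 (i : 'I_n) (C : {set 'I_n}) : i \notin C ->
  exists a b, [/\ enum (i |: C) = a ++ i :: b, enum C = a ++ b &
                  size a = #|[set k in C | (k < i)%N]|].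
Proof.
move=> iC; pose e := enum 'I_n.
have se : size e = n by rewrite size_enum_ord.
have ee : e = take i e ++ i :: drop i.+1 e.
  by rewrite -{1}(cat_take_drop i e) (drop_nth i) ?se // nth_ord_enum.
have ltA k : k \in take i e -> (k < i)%N.
  move=> /(nthP i) [l]; rewrite size_takel => [li <-|]; last by rewrite se ltnW.
  by rewrite nth_take // nth_enum_ord //; apply: ltn_trans li _.
have ltB k : k \in drop i.+1 e -> (i < k)%N.
  move=> /(nthP i) [l]; rewrite size_drop se => li <-.
  by rewrite nth_drop nth_enum_ord ?leq_addr // -ltn_subRL.
have eC (D : {set 'I_n}) : enum D = filter [in D] e by rewrite /e enumT; apply: eq_filter.
exists (filter [in C] (take i e)), (filter [in C] (drop i.+1 e)); split.
- rewrite eC {1}ee filter_cat /= setU11; congr (_ ++ _ :: _).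
    by apply: eq_in_filter => k /ltA ki; rewrite !inE -val_eqE ltn_eqF.
  by apply: eq_in_filter => k /ltB ki; rewrite !inE -val_eqE gtn_eqF.
- by rewrite eC {1}ee filter_cat /= (negPf iC).
- rewrite cardE eC {2}ee filter_cat /= inE (negPf iC) /= size_cat.
  rewrite [X in (_ + X)%N](_ : _ = 0%N) ?addn0; last first.
    apply/eqP; rewrite size_filter -leqn0 leqNgt -has_count; apply/hasPn => k /ltB ki.
    by rewrite inE ltnNge (ltnW ki) andbF.
  by congr size; apply: eq_in_filter => k /ltA ki; rewrite inE ki andbT.
Qed.

(** The letters to the right of [inl i] are the elements of [C] below [i], so the Jordan-Wigner sign
    is the cost of moving [inl i] past them. *)
Lemma annihilatorsU1 (i : 'I_n) (C : {set 'I_n}) : i \notin C ->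
  exists a b, [/\ annihilators (i |: C) = b ++ inl i :: a, annihilators C = b ++ a,
                  (-1) ^+ size a = jw_sign R (i |: C) i &
                  (-1) ^+ size a = jw_sign R C i].
Proof.
move=> /[dup] iC /enum_setU1 [a [b [eU eC sa]]].
exists (rev (map inl a)), (rev (map inl b)).
rewrite /annihilators eU eC !map_cat !rev_cat /= rev_cons cat_rcons size_rev size_map.
split=> //; rewrite sa /jw_sign //; congr (_ ^+ #|pred_of_set _|).
apply/setP => k; rewrite !inE.
by case: eqVneq => [->|] //=; rewrite ltnn andbF.
Qed.

Lemma mem_annihilators (C : {set 'I_n}) (a : T) :
  a \in annihilators C -> exists2 i, i \in C & a = inl i.
Proof. by rewrite mem_rev => /mapP [i]; rewrite mem_enum; exists i. Qed.

Lemma contr_annihilators i (C : {set 'I_n}) f :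
  contr (wick (inl i)) f (annihilators C) = 0.
Proof. by apply: contr0phi => a /mem_annihilators [k _ ->]. Qed.

Section Operators.
Variables (js : seq 'I_r) (psi : state R n).
Hypothesis psiE : forall C, psi C = pf wick (annihilators C ++ map inr js).

(** If [i] is in [C], the letter is repeated and the Pfaffian vanishes; otherwise moving it to its
    place gives the Jordan-Wigner sign. *)
Lemma cop_pf i C : cop i psi C = pf wick (annihilators C ++ inl i :: map inr js).
Proof.
rewrite /cop; case: ifPn => [iC | /annihilatorsU1 [a [b [eU eC sg _]]]].
  have /annihilatorsU1 [a [b [eU eC _ _]]] : i \notin C :\ i by rewrite setD11.
  rewrite -(setD1K iC) eU -catA /= (pf_move wick_skew b (inl i :: a)) /=.
  by rewrite (pf_move wick_skew [::]) /= (pf_repeat wick_skew) !mulr0.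
by rewrite psiE eC eU -!catA /= -sg -(pf_move wick_skew).
Qed.

(** A creation operator is not a letter of [T], so it enters through its antisymmetrised contraction
    with the preceding annihilators. Only [inl i] contributes, and removing it leaves [C :\ i]. *)
Lemma cdag_pf i C : cdag i psi C = (-1) ^+ size (annihilators C) *
  contr (fun a : T => - (a == inl i)%:R) (fun s => pf wick (s ++ map inr js)) (annihilators C).
Proof.
rewrite /cdag; case: ifPn => iC; last first.
  rewrite contr0phi ?mulr0 // => a /mem_annihilators [k kC ->].
  case: eqVneq => [[ki]|]; last by rewrite oppr0.
  by rewrite -ki kC in iC.
have iD : i \notin C :\ i by rewrite setD11.
have /annihilatorsU1 [a [b [eU eC _ sg]]] := iD.
have notin l : {subset l <= annihilators (C :\ i)} ->
    {in l, forall y : T, - (y == inl i)%:R = 0 :> R}.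
  move=> sub y /sub /mem_annihilators [k kC ->].
  case: eqVneq => [[ki]|]; last by rewrite oppr0.
  by rewrite ki (negPf iD) in kC.
rewrite setD1K // in eU; rewrite psiE eC eU contr_cat /= !contr0phi.
- rewrite eqxx mulN1r -sg size_cat /= -!catA addnS exprS exprD.
  set P := pf _ _; transitivity (((-1) ^+ size b) ^+ 2 * ((-1) ^+ size a * P)); last ring.
  by rewrite sqrr_sign mul1r.
- by apply: notin => y ya; rewrite eC mem_cat ya orbT.
- by apply: notin => y ya; rewrite eC mem_cat ya.
Qed.

Lemma Cop_pf (j : 'I_r) C : all (fun k : 'I_r => (j < k)%N) js ->
  Cop (fun i => X i j) psi C = pf wick (annihilators C ++ map inr (j :: js)).
Proof.
move=> /allP jlt; rewrite /Cop /= (pf_expand wick_skew).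
(* Against annihilators the letter [inr j] acts as its creation part, against the later letters as
   its annihilation part. *)
rewrite (@eq_in_contr _ _ _ (fun a => \sum_i X i j * - (a == inl i)%:R) _ (annihilators C)).
  rewrite (@eq_in_contr _ _ _ (fun a => \sum_i X i j * wick (inl i) a) _ (map _ _)).
    rewrite !contr_sum_phi mulr_sumr -big_split /=; apply: eq_bigr => i _.
    rewrite cop_pf cdag_pf (pf_expand wick_skew) contr_annihilators; ring.
  by move=> _ /mapP [k kjs ->]; rewrite wick_inr_lt ?jlt.
move=> _ /mem_annihilators [k _ ->] /=.
rewrite (bigD1 k) //= eqxx mulrN1 big1 ?addr0 // => i ik.
by rewrite (inj_eq (@inl_inj _ _)) eq_sym (negPf ik) oppr0 mulr0.
Qed.

End Operators.

Lemma amplitude_pf (js : seq 'I_r) C : pairwise (fun j k : 'I_r => (j < k)%N) js ->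
  foldr (fun j psi => Cop (fun i => X i j) psi) (@vac R n) js C =
    pf wick (annihilators C ++ map inr js).
Proof.
elim: js C => [|j js IH] C /=; last first.
  by move=> /andP [jlt pw]; apply: Cop_pf => // D; apply: IH.
move=> _; rewrite cats0 /vac; case: eqVneq => [->|].
  by rewrite /annihilators enum_set0.
(* A nonempty word of annihilators has only zero contractions. *)
rewrite -card_gt0 cardE -(size_map (@inl _ 'I_r)) -size_rev -/(annihilators C).
case e: (annihilators C) => [|a s] // _.
have [i _ ea] : exists2 i, i \in C & a = inl i.
  by apply: mem_annihilators; rewrite e mem_head.
rewrite pf_cons ea contr0phi // => y ys.
have [k _ ->] // : exists2 i, i \in C & y = inl i.
by apply: mem_annihilators; rewrite e inE ys orbT.
Qed.

Lemma columns_state_pf C :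
  columns_state X C = pf wick (annihilators C ++ map inr (enum 'I_r)).
Proof.
apply: amplitude_pf; rewrite -(pairwise_map val ltn) val_enum_ord.
by rewrite -sorted_pairwise ?iota_ltn_sorted //; apply: ltn_trans.
Qed.

End Amplitudes.

(** * Determinant formula and parity *)

Theorem mainTheorem5 (R : realFieldType) (n r : nat) (X : 'M[R]_(n, r))
  (unit_cols : forall j : 'I_r, \sum_(i < n) X i j ^+ 2 = 1)
  (rankX : \rank X = r) :
  (forall C : {set 'I_n},
     probY X C =
     \det (block_mx (0 : 'M[R]_(#|C|, #|C|)) (rowsub_set X C)
                    (- trmx (rowsub_set X C)) (skew_mx (trmx X *m X))))
  /\ \sum_(C : {set 'I_n} | odd #|C| != odd r) probY X C = 0.
Proof.
split=> [C|]; last first.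
  apply: big1 => C oC; rewrite /probY columns_state_pf pf_odd ?expr0n //.
  by rewrite size_cat size_rev 2!size_map -cardE size_enum_ord oddD -negb_eqb.
rewrite /probY columns_state_pf (sqr_pf_rev (wick_skew X)).
set s := _ ++ _.
have szl : size (map (@inl _ 'I_r) (enum C)) = #|C| by rewrite size_map -cardE.
have szs : size s = (#|C| + r)%N by rewrite size_cat szl size_map size_enum_ord.
(* For the empty word both sides are 1; otherwise its first letter serves as the default of
   [nth]. *)
case: (posnP (#|C| + r)) => [N0 | N_gt0].
  rewrite (size0nil (etrans szs N0)) expr1n.
  by move: (block_mx _ _ _ _); rewrite N0 => M; rewrite det_mx00.
case es: s (szs) => [|z0 s'] szs'; first by rewrite -szs' in N_gt0.
rewrite -es -(det_skew_pf z0 (wick_skew X) szs).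
have nth_row (i : 'I_#|C|) : nth z0 s i = inl (enum_val i).
  by rewrite nth_cat szl ltn_ord (nth_map (enum_val i)) -?cardE // -enum_val_nth.
have nth_col (j : 'I_r) : nth z0 s (#|C| + j) = inr j.
  rewrite nth_cat szl ltnNge leq_addr addKn (nth_map j) ?size_enum_ord //.
  by rewrite nth_ord_enum.
congr (\det _); apply/matrixP => i k; rewrite mxE.
case: (split_ordP i) => [i' ->|i' ->]; case: (split_ordP k) => [k' ->|k' ->].
- by rewrite block_mxEul !nth_row !mxE.
- by rewrite block_mxEur nth_row nth_col !mxE.
- by rewrite block_mxEdl nth_row nth_col !mxE.
- by rewrite block_mxEdr !nth_col.
Qed.
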